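(* Let $G$ be a Hausdorff topological group. Then the following conditions are equivalent: (i) $G$ embeds topologically into $S_{\mathbb{N}}$; (ii) $G$ embeds topologically into $I_{\mathbb{N}}$; (iii) $G$ embeds topologically into $\mathbb{N}^{\mathbb{N}}$; (iv) $G$ is second-countable and has a neighbourhood basis of the identity consisting of open subgroups.
   Context: $\mathbb{N}^{\mathbb{N}}$ is the monoid of all functions $\mathbb{N}\to\mathbb{N}$ under composition (functions act on the right and compose from left to right), with the product topology arising from the discrete topology on $\mathbb{N}$. $S_{\mathbb{N}}$ is the group of all permutations of $\mathbb{N}$ with the subspace topology from $\mathbb{N}^{\mathbb{N}}$. $I_{\mathbb{N}}$ is the symmetric inverse monoid of all partial permutations of $\mathbb{N}$ (bijections between subsets of $\mathbb{N}$) under composition of binary relations, with the topology generated by the subbasis consisting of the sets $U_{x,y}=\{h : (x,y)\in h\}$, $W_x=\{h : x\notin\operatorname{dom}(h)\}$ and $W_x^{-1}=\{h : x\notin\operatorname{im}(h)\}$, for $x,y\in\mathbb{N}$. An embedding of semigroups is an injective semigroup homomorphism (it need not send the identity of the group to the identity of the monoid); an embedding $\phi:S\to T$ of topological semigroups is topological if both $\phi$ and $\phi^{-1}:(S)\phi\to S$ are continuous, where $(S)\phi$ has the subspace topology. ''$S$ embeds topologically into $T$'' means such a topological embedding exists. *)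

(* Defs.v *)
From HB Require Import structures.
From mathcomp Require Import all_boot all_order all_algebra finmap.
From mathcomp Require Import all_classical reals topology.

Set Implicit Arguments.
Unset Strict Implicit.
Unset Printing Implicit Defensive.

Local Open Scope classical_set_scope.
Local Open Scope group_scope.

HB.structure Definition PreTopologicalSemigroup :=
  {S of Topological S & Semigroup S}.

HB.mixin Record PreTopologicalSemigroup_isTopologicalSemigroup S
    & PreTopologicalSemigroup S := {
  mulg_continuous : continuous (fun x : S * S => x.1 * x.2)
}.

#[short(type="topologicalSemigroupType")]
HB.structure Definition TopologicalSemigroup :=
  {S of PreTopologicalSemigroup S
      & PreTopologicalSemigroup_isTopologicalSemigroup S}.

HB.mixin Record TopologicalSemigroup_isTopologicalGroup G
    & Topological G & Group G := {
  invg_continuous : continuous (fun x : G => x^-1)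
}.

#[short(type="topologicalGroupType")]
HB.structure Definition TopologicalGroup :=
  {G of TopologicalSemigroup G & Group G
      & TopologicalSemigroup_isTopologicalGroup G}.

(* [range phi], used as a type, carries the subspace topology, and [psi] is
   necessarily the inverse of [phi] on it. *)
Definition topological_embedding (S T : topologicalSemigroupType)
    (phi : {multiplicative S -> T}) : Prop :=
  [/\ injective phi, continuous phi &
      exists2 psi : range phi -> S,
        (forall y, phi (psi y) = set_val y) & continuous psi].

Definition embeds_topologically (S T : topologicalSemigroupType) : Prop :=
  exists phi : {multiplicative S -> T}, topological_embedding phi.

Definition nbhs_basis (T : topologicalType) (x : T) (B : set (set T)) : Prop :=
  B `<=` nbhs x /\ filter_from B id --> x.

Definition transN : Type := prod_topology (fun _ : nat => nat).

HB.instance Definition _ := Topological.on transN.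

Section TransN.
Implicit Types f g h : transN.

(* Functions act on the right: [f * g] is [f] followed by [g]. *)
Definition mul_transN f g : transN := fun x => g (f x).
Definition one_transN : transN := fun x => x.

Lemma mul_transNA : associative mul_transN. Proof. by []. Qed.
Lemma mul_1transN : left_id one_transN mul_transN. Proof. by []. Qed.
Lemma mul_transN1 : right_id one_transN mul_transN. Proof. by []. Qed.

HB.instance Definition _ :=
  isMonoid.Build transN mul_transNA mul_1transN mul_transN1.

Lemma nbhs_transN f x y : f x = y -> nbhs f [set g : transN | g x = y].
Proof.
move=> fxy; have := @proj_continuous nat (fun=> nat) x f [set y].
by apply; rewrite /proj fxy; exact: discrete_set1.
Qed.

Lemma cvg_transN (F : set_system transN) f : Filter F ->
  (forall x, F [set g : transN | g x = f x]) -> F --> f.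
Proof.
move=> FF Ff; apply/cvg_sup => x U [V] [[W] oW <-] Wfx WU.
by apply: (filterS WU); apply: filterS (Ff x) => g /= gx; rewrite /= gx.
Qed.

Lemma mul_transN_continuous :
  continuous (fun x : transN * transN => x.1 * x.2).
Proof.
move=> [f g]; apply: cvg_transN => x.
exists ([set h : transN | h x = f x], [set h : transN | h (f x) = g (f x)]).
  by split; exact: nbhs_transN.
by case=> h k /= [hx kfx]; rewrite -[LHS]/(k (h x)) hx kfx.
Qed.

HB.instance Definition _ :=
  PreTopologicalSemigroup_isTopologicalSemigroup.Build transN
    mul_transN_continuous.

End TransN.

Definition symN : Type := [set f : transN | bijective f].

HB.instance Definition _ := Topological.on symN.

Section SymN.
Implicit Types f g h : symN.

Lemma symN_bij f : bijective (set_val f).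
Proof. exact: set_valP. Qed.

Lemma symN_inj f g : set_val f =1 set_val g -> f = g.
Proof. by move=> /funext fg; apply: val_inj. Qed.

Lemma mul_symN_subproof f g :
  set_val f * set_val g \in [set f : transN | bijective f].
Proof. by apply: mem_set; exact: bij_comp (symN_bij g) (symN_bij f). Qed.

Definition mul_symN f g : symN := SigSub (mul_symN_subproof f g).

Lemma one_symN_subproof : 1 \in [set f : transN | bijective f].
Proof. by apply: mem_set; exists (fun x => x). Qed.

Definition one_symN : symN := SigSub one_symN_subproof.

Lemma inv_symN_subproof f :
  {g : symN | cancel (set_val f) (set_val g) & cancel (set_val g) (set_val f)}.
Proof.
apply: cid2; have [g fg gf] := symN_bij f.
have gP : (g : transN) \in [set f : transN | bijective f].
  by apply: mem_set; exists (set_val f).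
by exists (SigSub gP).
Qed.

Definition inv_symN f : symN := s2val (inv_symN_subproof f).

Lemma inv_symNK f : cancel (set_val f) (set_val (inv_symN f)).
Proof. exact: s2valP (inv_symN_subproof f). Qed.

Lemma inv_symNVK f : cancel (set_val (inv_symN f)) (set_val f).
Proof. exact: s2valP' (inv_symN_subproof f). Qed.

Lemma mul_symNA : associative mul_symN.
Proof. by move=> f g h; apply: symN_inj. Qed.

Lemma mul_1symN : left_id one_symN mul_symN.
Proof. by move=> f; apply: symN_inj. Qed.

Lemma mul_symN1 : right_id one_symN mul_symN.
Proof. by move=> f; apply: symN_inj. Qed.

Lemma mul_VsymN : left_inverse one_symN inv_symN mul_symN.
Proof. by move=> f; apply: symN_inj => x; exact: inv_symNVK. Qed.

Lemma mul_symNV : right_inverse one_symN inv_symN mul_symN.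
Proof. by move=> f; apply: symN_inj => x; exact: inv_symNK. Qed.

HB.instance Definition _ :=
  isGroup.Build symN mul_symNA mul_1symN mul_symN1 mul_VsymN mul_symNV.

Lemma nbhs_symN f x y :
  set_val f x = y -> nbhs f [set g : symN | set_val g x = y].
Proof.
move=> /nbhs_transN; exact: (@initial_continuous symN transN set_val f).
Qed.

Lemma cvg_symN (F : set_system symN) f : Filter F ->
  (forall x, F [set g : symN | set_val g x = set_val f x]) -> F --> f.
Proof.
move=> FF Ff U [V] [[W] oW <-] Wf WU; rewrite nbhs_filterE.
apply: (filterS WU).
have /cvg_transN : forall x, (set_val @ F) [set g : transN | g x = set_val f x].
  exact: Ff.
by apply; apply: open_nbhs_nbhs.
Qed.

Lemma mul_symN_continuous : continuous (fun x : symN * symN => x.1 * x.2).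
Proof.
move=> [f g]; apply: cvg_symN => x.
exists ([set h : symN | set_val h x = set_val f x],
        [set h : symN | set_val h (set_val f x) = set_val g (set_val f x)]).
  by split; exact: nbhs_symN.
case=> h k /= [hx kfx].
by rewrite -[LHS]/(set_val k (set_val h x)) hx kfx.
Qed.

HB.instance Definition _ :=
  PreTopologicalSemigroup_isTopologicalSemigroup.Build symN mul_symN_continuous.

Lemma inv_symN_continuous : continuous (fun f : symN => f^-1).
Proof.
move=> f; apply: (@cvg_symN _ _ (fmap_filter _ (nbhs_filter f))) => x.
have : nbhs f [set h : symN | set_val h (set_val f^-1 x) = x].
  by apply: nbhs_symN; exact: inv_symNVK.
apply: filterS => h /= hx; rewrite -[in LHS]hx; exact: inv_symNK.
Qed.

HB.instance Definition _ :=
  TopologicalSemigroup_isTopologicalGroup.Build symN inv_symN_continuous.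

End SymN.

Record psymN : Type := PSymN {
  graph : set (nat * nat);
  graph_fun : forall x y y', graph (x, y) -> graph (x, y') -> y = y';
  graph_inj : forall x x' y, graph (x, y) -> graph (x', y) -> x = x'
}.

HB.instance Definition _ := gen_eqMixin psymN.
HB.instance Definition _ := gen_choiceMixin psymN.

Section PSymN.
Implicit Types f g h : psymN.

Definition psymN_subbase : set (set psymN) :=
  [set [set h | graph h p] | p in [set: nat * nat]] `|`
  [set [set h | ~ (graph h).`1 x] | x in [set: nat]] `|`
  [set [set h | ~ (graph h).`2 x] | x in [set: nat]].

HB.instance Definition _ := isSubBaseTopological.Build psymN psymN_subbase id.

Lemma psymN_eq f g : graph f = graph g -> f = g.
Proof.
case: f g => [f ff fi] [g gf gi] /= fg; move: gf gi; rewrite -fg => gf gi.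
by congr PSymN; exact: Prop_irrelevance.
Qed.

Definition mul_graph f g : set (nat * nat) :=
  [set xy | exists2 z, graph f (xy.1, z) & graph g (z, xy.2)].

Lemma mul_graph_fun f g x y y' :
  mul_graph f g (x, y) -> mul_graph f g (x, y') -> y = y'.
Proof.
move=> [z fxz gzy] [z' fxz' gzy']; rewrite (graph_fun fxz fxz') in gzy.
exact: graph_fun gzy gzy'.
Qed.

Lemma mul_graph_inj f g x x' y :
  mul_graph f g (x, y) -> mul_graph f g (x', y) -> x = x'.
Proof.
move=> [z fxz gzy] [z' fxz' gzy']; rewrite (graph_inj gzy gzy') in fxz.
exact: graph_inj fxz fxz'.
Qed.

Definition mul_psymN f g : psymN :=
  PSymN (@mul_graph_fun f g) (@mul_graph_inj f g).

Lemma one_graph_fun (x y y' : nat) :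
  diagonal (x, y) -> diagonal (x, y') -> y = y'.
Proof. by move=> /diagonalP <- /diagonalP. Qed.

Lemma one_graph_inj (x x' y : nat) :
  diagonal (x, y) -> diagonal (x', y) -> x = x'.
Proof. by move=> /diagonalP -> /diagonalP. Qed.

Definition one_psymN : psymN := PSymN one_graph_fun one_graph_inj.

Lemma mul_psymNA : associative mul_psymN.
Proof.
move=> f g h; apply: psymN_eq; apply/seteqP; split=> -[x y].
  by move=> [z fxz [t gzt hty]]; exists t => //; exists z.
by move=> [t [z fxz gzt] hty]; exists z => //; exists t.
Qed.

Lemma mul_1psymN : left_id one_psymN mul_psymN.
Proof.
move=> f; apply: psymN_eq; apply/seteqP; split=> -[x y] /=.
  by move=> [z /diagonalP /= ->].
by move=> fxy; exists x.
Qed.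

Lemma mul_psymN1 : right_id one_psymN mul_psymN.
Proof.
move=> f; apply: psymN_eq; apply/seteqP; split=> -[x y] /=.
  by move=> [z fxz /diagonalP /= <-].
by move=> fxy; exists y.
Qed.

HB.instance Definition _ :=
  isMonoid.Build psymN mul_psymNA mul_1psymN mul_psymN1.

Lemma nbhs_psymN f A : psymN_subbase A -> A f -> nbhs f A.
Proof.
move=> DA Af; exists A; split=> //; exists [set A]; last first.
  by rewrite predeqE => ?; split=> [[_ ->]|] //; exists A.
move=> _ ->; exists [fset A]%fset; first by move=> B /fset1P ->; exact: mem_set.
by rewrite predeqE=> ?; split=> [|??]; [apply|]; rewrite /= inE // =>/eqP->.
Qed.

Lemma cvg_psymN (F : set_system psymN) f : Filter F ->
  (forall A, psymN_subbase A -> A f -> F A) -> F --> f.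
Proof.
move=> FF Ff A [_ [[B sB <-] [C BC Cf] sUBA]].
rewrite nbhs_filterE; apply: filterS sUBA _; apply: (@filterS _ _ _ C).
  by move=> ? ?; exists C.
have /sB [D sD IDeC] := BC; rewrite -IDeC; apply: filter_bigI => E DE.
by apply: Ff; [exact/set_mem/sD|move: Cf; rewrite -IDeC; apply].
Qed.

Lemma nbhs_psymN_graph f x y :
  graph f (x, y) -> nbhs f [set h | graph h (x, y)].
Proof. by move=> fxy; apply: nbhs_psymN => //; left; left; exists (x, y). Qed.

Lemma nbhs_psymN_dom f x :
  ~ (graph f).`1 x -> nbhs f [set h | ~ (graph h).`1 x].
Proof. by move=> fx; apply: nbhs_psymN => //; left; right; exists x. Qed.

Lemma nbhs_psymN_im f y :
  ~ (graph f).`2 y -> nbhs f [set h | ~ (graph h).`2 y].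
Proof. by move=> fy; apply: nbhs_psymN => //; right; exists y. Qed.

Lemma mul_psymN_continuous : continuous (fun x : psymN * psymN => x.1 * x.2).
Proof.
move=> [f g]; apply: cvg_psymN => A [[|]|].
- move=> [[x y] _ <-] [z fxz gzy].
  exists ([set h | graph h (x, z)], [set h | graph h (z, y)]).
    by split; exact: nbhs_psymN_graph.
  by case=> h k /= [hxz kzy]; exists z.
- move=> [x _ <-] /= fgx.
  have [[z fxz]|fx] := pselect ((graph f).`1 x); last first.
    exists ([set h | ~ (graph h).`1 x], setT).
      by split; [exact: nbhs_psymN_dom|exact: filterT].
    by case=> h k /= [hx _] [y [z hxz _]]; apply: hx; exists z.
  exists ([set h | graph h (x, z)], [set h | ~ (graph h).`1 z]).
    split; first exact: nbhs_psymN_graph.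
    by apply: nbhs_psymN_dom => -[y gzy]; apply: fgx; exists y, z.
  case=> h k /= [hxz kz] [y [t hxt kty]]; apply: kz; exists y.
  by rewrite (graph_fun hxz hxt).
- move=> [y _ <-] /= fgy.
  have [[z gzy]|gy] := pselect ((graph g).`2 y); last first.
    exists (setT, [set h | ~ (graph h).`2 y]).
      by split; [exact: filterT|exact: nbhs_psymN_im].
    by case=> h k /= [_ ky] [x [z _ kzy]]; apply: ky; exists z.
  exists ([set h | ~ (graph h).`2 z], [set h | graph h (z, y)]).
    split; last exact: nbhs_psymN_graph.
    by apply: nbhs_psymN_im => -[x fxz]; apply: fgy; exists x, z.
  case=> h k /= [hz kzy] [x [t hxt kty]]; apply: hz; exists x.
  by rewrite (graph_inj kzy kty).
Qed.

HB.instance Definition _ :=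
  PreTopologicalSemigroup_isTopologicalSemigroup.Build psymN
    mul_psymN_continuous.

End PSymN.

(* Main.v *)
Require Import Defs.
From HB Require Import structures.
From mathcomp Require Import all_boot all_order all_algebra.
From mathcomp Require Import all_classical reals topology.

(**
Everything is expressed through convergence of filters. When the source is
Hausdorff, a morphism is a topological embedding exactly when a filter
converges to g if and only if its image converges to the image of g
([topological_embeddingP]): injectivity comes for free from uniqueness of
limits. In the full transformation monoid and in the symmetric group
convergence is pointwise, i.e. each point x is eventually sent to its limit
value. In the symmetric inverse monoid the same is true along a group G: all
elements of G have the same image under dom and the same image under im, since
each of them divides each other one, so the subbasic sets about domains and
images impose nothing and only the pairs of the graph matter
([cvg_group_psymNP]).

Four constructions then close the cycle.

- A permutation is a partial permutation, which gives (i) => (ii).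

- A partial permutation becomes a transformation by adding a sink where the
  undefined values go, which gives (ii) => (iii).

- If phi embeds G into the transformations, the sets of all g such that phi g
  takes prescribed values on an initial segment of the naturals form a
  countable basis, and those that prescribe the values of phi 1 are open
  subgroups, even though phi 1 may be a proper idempotent. This is
  (iii) => (iv).

- From (iv), extract countably many open subgroups K n, small enough to form a
  basis at 1, and a dense sequence d. Every right coset of K n contains some
  d i, so G acts on the right on the pairs (n, i), the second component being
  a name of the coset of d i. This is a morphism into the transformations
  ([coset_actM]); it is not unital, because a coset has many names, only one
  of which is chosen. Here k and l agree on (n, i) exactly when k / l lies in
  the conjugate of K n by d i, so pointwise convergence is convergence in G.
  Finally any group of transformations acts by permutations on the image of
  its idempotent phi 1; extending this action by the identity gives
  permutations of the naturals with the same pointwise convergence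
  ([embeds_transN_symN]), which is (iv) => (i).
*)

Set Implicit Arguments.
Unset Strict Implicit.
Unset Printing Implicit Defensive.

Local Open Scope classical_set_scope.
Local Open Scope group_scope.

(** * Embeddings and convergence of filters *)

(** Continuity of phi and of its inverse are the two implications. For the
    converse, if h and g have the same image then the principal filter at h
    converges to g, which in a Hausdorff space forces h = g. *)
Lemma topological_embeddingP (S T : topologicalSemigroupType)
    (phi : {multiplicative S -> T}) : hausdorff_space S ->
  topological_embedding phi <->
  forall (F : set_system S) g, Filter F -> F --> g <-> phi @ F --> phi g.
Proof.
move=> hausS; split=> [[phiI phiC [psi psiK psiC]] F g FF|cvgE].
  split=> [Fg|Fg V Vg]; first exact: cvg_comp Fg (phiC g).
  have phiP h : phi h \in range phi by apply/mem_set; exists h.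
  pose y h : range phi := SigSub (phiP h).
  have psiy h : psi (y h) = h by apply/phiI/psiK.
  have : nbhs (y g) (psi @^-1` V) by apply: psiC; rewrite psiy.
  move=> [U [[W oW <-] /= Wg WV]].
  have : F (phi @^-1` W) by apply: Fg; apply: open_nbhs_nbhs.
  rewrite nbhs_filterE; apply: filterS => h Wh.
  by rewrite -[h]psiy; exact: WV.
have phiI : injective phi.
  move=> h g phihg; apply: hausS => A B Ah Bg; exists h.
  split; first exact: nbhs_singleton.
  have /cvgE : phi @ globally [set h] --> phi g.
    by move=> W Wg k -> /=; rewrite phihg; exact: nbhs_singleton.
  by move=> /(_ B Bg); apply.
have phiC : continuous phi by move=> g; apply/cvgE.
have /choice[psi psiK] : forall y : range phi, exists g, phi g = set_val y.
  by move=> y; have [g _ gy] := set_valP y; exists g.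
split=> //; exists psi => // y; apply/cvgE.
  exact: (fmap_filter _ (nbhs_filter y)).
rewrite psiK.
apply: (@cvg_trans _ (set_val @ nbhs y)); last exact: initial_continuous.
by move=> W /=; rewrite !nbhs_filterE /=; apply: filterS => z /=; rewrite psiK.
Qed.

Lemma cvg_transNP (F : set_system transN) (f : transN) : Filter F ->
  F --> f <-> forall x, F [set h : transN | h x = f x].
Proof.
move=> FF; split=> [Ff x|]; last exact: cvg_transN.
exact/Ff/nbhs_transN.
Qed.

Lemma cvg_symNP (F : set_system symN) (f : symN) : Filter F ->
  F --> f <-> forall x, F [set h : symN | set_val h x = set_val f x].
Proof.
move=> FF; split=> [Ff x|]; last exact: cvg_symN.
exact/Ff/nbhs_symN.
Qed.

(** * From permutations to partial permutations *)

Section GroupInMonoid.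
Variable G : topologicalGroupType.

Lemma graph_dom_mul (f g : psymN) x : (graph (f * g)).`1 x -> (graph f).`1 x.
Proof. by move=> [y [z fxz _]]; exists z. Qed.

Lemma graph_im_mul (f g : psymN) y : (graph (f * g)).`2 y -> (graph g).`2 y.
Proof. by move=> [x [z _ gzy]]; exists z. Qed.

Variable phi : {multiplicative G -> psymN}.

(** All elements of a group of partial permutations have the same domain,
    because g = h * (h^-1 * g) restricts the domain of h. *)
Lemma group_psymN_dom g h x : (graph (phi g)).`1 x -> (graph (phi h)).`1 x.
Proof. by rewrite -[g](mulVKg h) gmulfM; exact: graph_dom_mul. Qed.

Lemma group_psymN_im g h y : (graph (phi g)).`2 y -> (graph (phi h)).`2 y.
Proof. by rewrite -[g](mulgVK h) gmulfM; exact: graph_im_mul. Qed.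

(** Domain and image being constant on G, only the graph part of the subbasis
    constrains convergence. *)
Lemma cvg_group_psymNP (F : set_system G) g : Filter F ->
  phi @ F --> phi g <->
  forall x y, graph (phi g) (x, y) ->
    \forall h \near F, graph (phi h) (x, y).
Proof.
move=> FF; split=> [Fg x y gxy|Fg].
  exact: Fg (nbhs_psymN_graph gxy).
apply: cvg_psymN => A [[[[x y] _ <-]|[x _ <-]]|[y _ <-]] /=; first exact: Fg.
- by move=> gx; apply: filterE => h /(group_psymN_dom g)/gx.
- by move=> gy; apply: filterE => h /(group_psymN_im g)/gy.
Qed.

End GroupInMonoid.

Section PartialOfPermutation.

Lemma psym_of_sym_fun (f : symN) x y y' :
  set_val f x = y -> set_val f x = y' -> y = y'.
Proof. by move=> ->. Qed.

Lemma psym_of_sym_inj (f : symN) x x' y :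
  set_val f x = y -> set_val f x' = y -> x = x'.
Proof. by move=> <- /(bij_inj (symN_bij f)). Qed.

Definition psym_of_sym (f : symN) : psymN :=
  @PSymN [set xy | set_val f xy.1 = xy.2]
    (@psym_of_sym_fun f) (@psym_of_sym_inj f).

Lemma psym_of_symM : {morph psym_of_sym : f g / f * g}.
Proof.
move=> f g; apply: psymN_eq; apply/seteqP; split=> -[x y] /=.
  by move=> fgxy; exists (set_val f x).
by move=> [z /= <- <-].
Qed.

HB.instance Definition _ :=
  isMultiplicative.Build symN psymN psym_of_sym psym_of_symM.

End PartialOfPermutation.

Lemma embeds_symN_psymN (G : topologicalGroupType) : hausdorff_space G ->
  embeds_topologically G symN -> embeds_topologically G psymN.
Proof.
move=> hausG [phi /(topological_embeddingP _ hausG) phiP].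
exists (psym_of_sym \o phi : {multiplicative G -> psymN}).
apply/(topological_embeddingP _ hausG) => F g FF.
rewrite cvg_group_psymNP phiP cvg_symNP; split=> [Fg x y /= <-|Fg x].
  exact: Fg.
exact: Fg.
Qed.

(** * From partial permutations to transformations *)

Section TransOfPartial.

(** The naturals are shifted by one to make room for the sink 0, which receives
    the points outside the domain. *)
Definition trans_of_psym (f : psymN) : transN := fun x =>
  if x is x'.+1 then
    (xget 0%N [set y | exists2 y', y = y'.+1 & graph f (x', y')])
  else 0%N.

Lemma trans_of_psymS f x y : trans_of_psym f x.+1 = y.+1 <-> graph f (x, y).
Proof.
rewrite /trans_of_psym; split.
  by case: xgetP => // _ -> [y' -> fxy'] [<-].
move=> fxy; case: xgetP => [_ -> [y' -> fxy']|/(_ y.+1)[]]; last by exists y.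
by rewrite (graph_fun fxy fxy').
Qed.

Lemma trans_of_psym0 f x : ~ (graph f).`1 x -> trans_of_psym f x.+1 = 0%N.
Proof.
move=> fx; case fxy : (trans_of_psym f x.+1) => [//|y].
by case: fx; exists y; exact/trans_of_psymS.
Qed.

Lemma trans_of_psym_eqS f h x y : graph f (x, y) ->
  trans_of_psym h x.+1 = trans_of_psym f x.+1 <-> graph h (x, y).
Proof. by move=> /trans_of_psymS ->; exact: trans_of_psymS. Qed.

Lemma trans_of_psymM : {morph trans_of_psym : f g / f * g}.
Proof.
move=> f g; apply/funext=> -[//|x].
rewrite -[RHS]/(trans_of_psym g (trans_of_psym f x.+1)).
case fx : (trans_of_psym f x.+1) => [|z]; last first.
  move/trans_of_psymS : fx => fxz.
  case gz : (trans_of_psym g z.+1) => [|y].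
    case fgx : (trans_of_psym (f * g) x.+1) => [//|y].
    move/trans_of_psymS : fgx => [z' /= fxz'].
    by rewrite (graph_fun fxz' fxz) -trans_of_psymS gz.
  by apply/trans_of_psymS; exists z => //; apply/trans_of_psymS.
case fgx : (trans_of_psym (f * g) x.+1) => [//|y].
by move/trans_of_psymS : fgx => [z /trans_of_psymS]; rewrite fx.
Qed.

HB.instance Definition _ :=
  isMultiplicative.Build psymN transN trans_of_psym trans_of_psymM.

End TransOfPartial.

Lemma embeds_psymN_transN (G : topologicalGroupType) : hausdorff_space G ->
  embeds_topologically G psymN -> embeds_topologically G transN.
Proof.
move=> hausG [phi /(topological_embeddingP _ hausG) phiP].
exists (trans_of_psym \o phi : {multiplicative G -> transN}).
apply/(topological_embeddingP _ hausG) => F g FF.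
rewrite phiP cvg_group_psymNP cvg_transNP; split=> [Fg [|x]|Fg x y gxy].
- by rewrite nbhs_filterE; apply: (@filterE _ F).
- have [[y gxy]|gx] := pselect ((graph (phi g)).`1 x).
    have := Fg x y gxy; rewrite !nbhs_filterE; apply: filterS => h hxy.
    exact/(trans_of_psym_eqS _ gxy).
  rewrite nbhs_filterE; apply: (@filterE _ F) => h.
  apply: (etrans (trans_of_psym0 _) (esym (trans_of_psym0 gx))).
  by move=> /(group_psymN_dom g)/gx.
- apply: (@filterS _ F FF _ _ _ (Fg x.+1)) => h hx.
  exact: (trans_of_psym_eqS (phi h) gxy).1 hx.
Qed.

(** * From transformations to permutations *)

Section SymOfTrans.
Variables (G : groupType) (phi : {multiplicative G -> transN}).

Lemma transN_morphM g h x : phi (g * h) x = phi h (phi g x).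
Proof. by rewrite gmulfM. Qed.

Lemma transN_morph1l g x : phi g (phi 1 x) = phi g x.
Proof. by rewrite -transN_morphM mul1g. Qed.

Lemma transN_morph1r g x : phi 1 (phi g x) = phi g x.
Proof. by rewrite -transN_morphM mulg1. Qed.

(** The fixed points of the idempotent [phi 1] form its image, on which the
    group acts by permutations; the other points are left fixed. *)
Definition sym_trans_fun g : transN := fun x =>
  if phi 1 x == x then phi g x else x.

Lemma sym_trans_funM g h x :
  sym_trans_fun (g * h) x = sym_trans_fun h (sym_trans_fun g x).
Proof.
rewrite /sym_trans_fun; case: ifPn => [_|/negPf-> //].
by rewrite transN_morph1r eqxx transN_morphM.
Qed.

Lemma sym_trans_fun1 x : sym_trans_fun 1 x = x.
Proof. by rewrite /sym_trans_fun; case: eqP. Qed.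

Lemma sym_trans_subproof g : sym_trans_fun g \in [set f : transN | bijective f].
Proof.
apply/mem_set; exists (sym_trans_fun g^-1) => x.
  by rewrite -sym_trans_funM mulgV sym_trans_fun1.
by rewrite -sym_trans_funM mulVg sym_trans_fun1.
Qed.

Definition sym_trans g : symN := SigSub (sym_trans_subproof g).

Lemma sym_transE g x :
  set_val (sym_trans g) x = if phi 1 x == x then phi g x else x.
Proof. by []. Qed.

Lemma sym_transM : {morph sym_trans : g h / g * h}.
Proof. by move=> g h; apply: symN_inj => x; exact: sym_trans_funM. Qed.

HB.instance Definition _ :=
  isMultiplicative.Build G symN sym_trans sym_transM.

End SymOfTrans.

(** The restriction to the image of [phi 1] loses nothing, since
    [phi g x = phi g (phi 1 x)]. *)
Lemma embeds_transN_symN (G : topologicalGroupType) : hausdorff_space G ->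
  embeds_topologically G transN -> embeds_topologically G symN.
Proof.
move=> hausG [phi /(topological_embeddingP _ hausG) phiP].
exists (sym_trans phi : {multiplicative G -> symN}).
apply/(topological_embeddingP _ hausG) => F g FF.
rewrite phiP cvg_transNP cvg_symNP; split=> Fg x.
  apply: (@filterS _ F FF _ _ _ (Fg x)) => h /= hx.
  by rewrite !sym_transE hx.
(* The value of phi h at x is read at the point phi 1 x of the image. *)
apply: (@filterS _ F FF _ _ _ (Fg (phi 1 x))) => h /=.
by rewrite !sym_transE transN_morph1r eqxx !transN_morph1l.
Qed.

(** * From transformations to a countable basis and open subgroups *)

Section Cylinders.
Variables (G : topologicalGroupType) (phi : {multiplicative G -> transN}).

Definition cylinder (s : seq nat) : set G :=
  [set g | forall i, (i < size s)%N -> phi g i = nth 0%N s i].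

Definition prefix g n := mkseq (phi g) n.

Lemma cylinder_prefix g n h :
  cylinder (prefix g n) h <-> forall i, (i < n)%N -> phi h i = phi g i.
Proof.
by split=> gh i; have := gh i; rewrite size_mkseq => {}gh i_n;
  have := gh i_n; rewrite nth_mkseq.
Qed.

Lemma open_cylinder s : continuous phi -> open (cylinder s).
Proof.
move=> phiC; rewrite openE => g gs; rewrite /interior.
elim/last_ind: s gs => [|s y IHs] gs; first by apply: filterE.
have {}/IHs IHs : cylinder s g.
  move=> i i_s; have := gs i; rewrite size_rcons nth_rcons i_s; apply.
  exact: ltnW.
have gy : phi g (size s) = y.
  by have := gs (size s); rewrite size_rcons nth_rcons ltnn eqxx; apply.
have gsize : nbhs g [set h | phi h (size s) = y].
  by rewrite -gy; have /cvg_transNP/(_ (size s)) := phiC g.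
apply: filterS2 IHs gsize => h hs hy i; rewrite size_rcons ltnS nth_rcons.
rewrite leq_eqVlt => /predU1P[->|i_s]; first by rewrite ltnn eqxx hy.
by rewrite i_s; exact: hs.
Qed.

(** These cylinders already give pointwise convergence to [phi g], so they are
    as fine as the neighbourhoods of g. *)
Lemma cvg_cylinder g : hausdorff_space G -> topological_embedding phi ->
  filter_from setT (fun n => cylinder (prefix g n)) --> g.
Proof.
move=> hausG /(topological_embeddingP _ hausG) phiP.
have FF : Filter (filter_from setT (fun n => cylinder (prefix g n))).
  apply: filter_fromT_filter => [|m n]; first by exists 0%N.
  exists (maxn m n) => h /cylinder_prefix hg.
  split; apply/cylinder_prefix => i i_n; apply: hg.
    by rewrite leq_max i_n.
  by rewrite leq_max i_n orbT.
apply/phiP/cvg_transNP => x.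
by exists x.+1 => // h /cylinder_prefix; apply.
Qed.

(** If g and h act like 1 at i, then
    [phi (g / h) i = phi h^-1 (phi 1 i) = phi h^-1 (phi h i) = phi 1 i]. *)
Lemma cylinder1_group n : group_closed [in cylinder (prefix 1 n)].
Proof.
split=> [|g h]; rewrite !inE; first exact/cylinder_prefix.
move=> /cylinder_prefix g1 /cylinder_prefix h1; apply/cylinder_prefix => i i_n.
by rewrite transN_morphM g1// -[in LHS]h1// -transN_morphM mulgV.
Qed.

End Cylinders.

Lemma embeds_transN_basis (G : topologicalGroupType) : hausdorff_space G ->
  embeds_topologically G transN ->
  @second_countable G /\
  (exists2 B : set (set G), nbhs_basis 1 B &
     forall H, B H -> open H /\ group_closed [in H]).
Proof.
move=> hausG [phi emb]; have [_ phiC _] := emb.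
have cylC s : open (cylinder phi s) by exact: open_cylinder.
split.
  exists (range (cylinder phi)).
    exact: sub_countable (card_image_le _ _) (countableP _).
  split=> [_ [s _ <-] //|g V /(cvg_cylinder hausG emb)[n _ nV]].
  exists (cylinder phi (prefix phi g n)) => //.
  by split=> //; apply/cylinder_prefix.
exists (range (fun n => cylinder phi (prefix phi 1 n))).
  split=> [_ [n _ <-]|V /(cvg_cylinder hausG emb)[n _ nV]].
    by apply: open_nbhs_nbhs; split=> //; apply/cylinder_prefix.
  by exists (cylinder phi (prefix phi 1 n)).
by move=> _ [n _ <-]; split=> //; exact: cylinder1_group.
Qed.

(** * From open subgroups to transformations *)

(** The action of G by right translation on the disjoint union of the sets of
    right cosets of the [K n], where cosets are named through the sequence d
    and pairs of naturals are encoded as naturals. *)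
Section CosetAction.
Variables (G : groupType) (K : nat -> set G) (d : nat -> G).
Hypothesis K_group : forall n, group_closed [in K n].
Hypothesis d_meets_cosets : forall n g, exists i, K n (d i / g).

Let KV n x : K n x -> K n x^-1.
Proof. by move=> Kx; apply/set_mem/(group_closedV (K_group n))/mem_set. Qed.

Let KM n x y : K n x -> K n y -> K n (x * y).
Proof.
by move=> Kx Ky; apply/set_mem/(group_closedM (K_group n)); exact/mem_set.
Qed.

(** A name of the right coset of g. It depends on that coset only, because the
    choice operator is applied to a set that is determined by the coset. *)
Definition coset_rep n g := xget 0%N [set i | K n (d i / g)].

Lemma coset_repP n g : K n (d (coset_rep n g) / g).
Proof. exact: (xgetPex _ (d_meets_cosets n g)). Qed.

Lemma eq_coset_rep n g h : coset_rep n g = coset_rep n h <-> K n (g / h).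
Proof.
split=> [gh|Kgh].
  have := KM (KV (coset_repP n g)) (coset_repP n h).
  by rewrite gh invgM invgK mulgA mulgVK.
rewrite /coset_rep; congr xget; apply/seteqP; split=> i /= Ki.
  by have := KM Ki Kgh; rewrite mulgA mulgVK.
by have := KM Ki (KV Kgh); rewrite invgM invgK mulgA mulgVK.
Qed.

Definition coset_act (k : G) : transN := fun x =>
  if unpickle x is Some (n, i) then pickle (n, coset_rep n (d i * k)) else x.

Lemma coset_actE k n i :
  coset_act k (pickle (n, i)) = pickle (n, coset_rep n (d i * k)).
Proof. by rewrite /coset_act pickleK. Qed.

Lemma coset_actM : {morph coset_act : k l / k * l}.
Proof.
move=> k l; apply/funext => x.
rewrite -[RHS]/(coset_act l (coset_act k x)) {1 3}/coset_act.
case Ex : (unpickle x) => [[n i]|]; last by rewrite /coset_act Ex.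
rewrite coset_actE; congr (pickle (n, _)); apply/eq_coset_rep.
have := KV (coset_repP n (d i * k)).
by rewrite !(invgM, invgK) !mulgA mulgK.
Qed.

(** The decoding of pairs is neither total nor known to be injective; this
    reduces pointwise convergence to the points that are codes. *)
Lemma coset_act_pickle x :
  (exists n i : nat, forall k, coset_act k x = coset_act k (pickle (n, i))) \/
  (forall k, coset_act k x = x).
Proof.
case Ex : (unpickle x : option (nat * nat)) => [[n i]|].
  by left; exists n, i => k; rewrite coset_actE /coset_act Ex.
by right=> k; rewrite /coset_act Ex.
Qed.

Lemma eq_coset_act k l n i :
  coset_act k (pickle (n, i)) = coset_act l (pickle (n, i)) <->
  K n (d i * (k / l) / d i).
Proof.
rewrite !coset_actE; have -> : d i * (k / l) / d i = d i * k / (d i * l).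
  by rewrite invgM !mulgA.
rewrite -eq_coset_rep; split=> [|->//].
by move=> /(pcan_inj pickleK)[].
Qed.

End CosetAction.

(** A sequence is more convenient than a countable set: since the members are
    only required to be fine enough, the empty set can fill unused indices. *)
Lemma second_countable_seq (T : topologicalType) : @second_countable T ->
  exists b : nat -> set T, forall (x : T) V, nbhs x V ->
    exists2 n, nbhs x (b n) & b n `<=` V.
Proof.
move=> [B /countable_injP[f fI] [Bo Bx]].
exists (fun n => xget set0 [set U | B U /\ f U = n]) => x V /Bx[U [BU Ux] UV].
exists (f U); case: xgetP => [W _ [BW /fI WU]|/(_ U)[]//];
  rewrite WU ?inE//; exact: open_nbhs_nbhs (conj (Bo _ BU) Ux).
Qed.

Lemma cvgMg (S : topologicalSemigroupType) (T : Type) (F : set_system T)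
    (f h : T -> S) (a b : S) {FF : Filter F} :
  f @ F --> a -> h @ F --> b -> (fun x => f x * h x) @ F --> a * b.
Proof.
apply: (@continuous2_cvg _ _ _ _ _ FF _ _ *%g).
exact: (mulg_continuous (a, b)).
Qed.

Lemma cvg_conj_div (G : topologicalGroupType) (a g : G) :
  (fun x => a * (x / g) / a) @ g --> (1 : G).
Proof.
have -> : (1 : G) = a * (g / g) / a by rewrite mulgV mulg1 mulgV.
apply: (cvgMg (FF := nbhs_filter g)); last exact: cvg_cst.
apply: (cvgMg (FF := nbhs_filter g)); first exact: cvg_cst.
by apply: (cvgMg (FF := nbhs_filter g)); [exact: cvg_id|exact: cvg_cst].
Qed.

Lemma basis_embeds_transN (G : topologicalGroupType) : hausdorff_space G ->
  @second_countable G ->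
  (exists2 B : set (set G), nbhs_basis 1 B &
     forall H, B H -> open H /\ group_closed [in H]) ->
  embeds_topologically G transN.
Proof.
move=> hausG /second_countable_seq[b bP] [B [_ B1] BP].
pose K n := xget setT [set H | B H /\ H `<=` b n].
pose d i := xget 1 (b i).
have KP n : open (K n) /\ group_closed [in K n].
  rewrite /K; case: xgetP => [H _ [/BP]//|_]; split; first exact: openT.
  by split=> [|x y]; rewrite !inE.
have K_nbhs n : nbhs 1 (K n).
  have [Ko [/set_mem K1 _]] := KP n.
  exact: open_nbhs_nbhs.
have K_small V : nbhs 1 V -> exists n, K n `<=` V.
  move=> /bP[n /B1[H BH Hn] nV]; exists n; rewrite /K.
  case: xgetP => [L _ [_ Ln]|/(_ H)[]//].
  exact: subset_trans Ln nV.
(* The points d i are dense, and K n * g is a neighbourhood of g. *)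
have d_meets n g : exists i, K n (d i / g).
  have /bP[i /nbhs_singleton ig iK] : nbhs g [set x | K n (x / g)].
    have := @cvg_conj_div G 1 g _ (K_nbhs n).
    by under eq_fun do rewrite mul1g divg1.
  by exists i; apply: iK; exact: xgetPex (ex_intro _ g ig).
have Kg n := (KP n).2.
pose phiM := isMultiplicative.Build G transN _ (coset_actM Kg d_meets).
pose phi : {multiplicative G -> transN} := HB.pack (coset_act K d) phiM.
exists phi; apply/(topological_embeddingP _ hausG) => F g FF.
rewrite cvg_transNP.
split=> [Fg x|Fg V Vg].
  have [[n [i xE]]|xE] := coset_act_pickle K d x; last first.
    by apply: (@filterE _ F) => h /=; rewrite [LHS]xE [RHS]xE.
  apply: (@filterS _ F FF _ _ _ (Fg _ (cvg_conj_div (d i) g (K_nbhs n)))).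
  move=> h Kh; apply: etrans (xE h) (etrans _ (esym (xE g))).
  exact/(eq_coset_act Kg d_meets).
have [n nV] : exists n, K n `<=` [set u | V (u * g)].
  apply: K_small; have : (fun u : G => u * g) @ 1 --> (1 : G) * g.
    by apply: (cvgMg (FF := nbhs_filter _)); [exact: cvg_id|exact: cvg_cst].
  by rewrite mul1g => /(_ V Vg).
(* For d i in K n, the conjugate of K n by d i is K n itself. *)
have [i] := d_meets n 1; rewrite divg1 => Kdi.
have := Fg (pickle (n, i)); apply: (@filterS _ F FF) => h.
move=> /(eq_coset_act Kg d_meets) Kh.
have KM := group_closedM (Kg n).
have : K n (h / g).
  have /set_mem : (d i)^-1 * (d i * (h / g) / d i) * d i \in K n.
    by apply: (KM); first (apply: KM; first apply: (group_closedV (Kg n)));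
      exact: mem_set.
  by rewrite !mulgA mulVg mul1g mulgVK.
by move=> /nV /=; rewrite mulgVK.
Qed.

Theorem theorem2p5 (G : topologicalGroupType) (hausG : hausdorff_space G) :
  [<-> embeds_topologically G symN;
       embeds_topologically G psymN;
       embeds_topologically G transN;
       @second_countable G /\
       (exists2 B : set (set G), nbhs_basis 1 B &
          forall H, B H -> open H /\ group_closed [in H])].
Proof.
tfae; [exact: embeds_symN_psymN|exact: embeds_psymN_transN|
       exact: embeds_transN_basis|].
by move=> [scG /(basis_embeds_transN hausG scG)]; exact: embeds_transN_symN.
Qed.
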